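(* Let $K,N,M\in\mathbb N$, let $(\mu^{(k)},\nu^{(k)})\in\Delta_N\times\Delta_M$, $k\in\{1,\dots,K\}$, be $K$ distinct pairs of marginals, and let $\alpha^{(k)}\in\mathbb R$ (total costs) and $(f^{(k)},g^{(k)})\in\mathbb R^N\times\mathbb R^M$ (optimal potentials), $k\in\{1,\dots,K\}$, be observed, where $\alpha^{(k)}=\langle f^{(k)},\mu^{(k)}\rangle+\langle g^{(k)},\nu^{(k)}\rangle$. For each choice of extreme points $u^{(k)}\in\operatorname{EP}(\mu^{(k)},\nu^{(k)})$, $k\in\{1,\dots,K\}$, consider the following system in the unknown $c\in\mathbb R^{N\times M}$, required for every $k\in\{1,\dots,K\}$: $$\langle c,v^{(k)}\rangle\ge\alpha^{(k)}\ \text{ for all } v^{(k)}\in\operatorname{EP}(\mu^{(k)},\nu^{(k)})\setminus\{u^{(k)}\},\qquad \langle c,u^{(k)}\rangle=\alpha^{(k)},$$ $$c\ge f^{(k)}\oplus g^{(k)}\ \text{ entrywise, with equality on } \operatorname{supp}u^{(k)}.\tag{$*$}$$ (a) Suppose that at least one consistent cost matrix exists. Then the cost matrix is identifiable in $\mathbb R^{N\times M}$ from the marginals, total costs and optimal potentials if and only if, for all possible choices of $u^{(k)}\in\operatorname{EP}(\mu^{(k)},\nu^{(k)})$, $k\in\{1,\dots,K\}$, the system $( * )$ is either inconsistent (has no solution) or has a unique solution, and this solution does not depend on the choice of $(u^{(k)})_k$. (b) (Without assuming in advance that a consistent cost matrix exists.) If $( * )$ has a solution for some choice of $(u^{(k)})_k$,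 then a consistent cost matrix exists.
   Context: $\Delta_N=\{x\in\mathbb R^N: x_i\ge 0,\ \sum_i x_i=1\}$. For $\mu\in\Delta_N$, $\nu\in\Delta_M$, $\Pi(\mu,\nu)$ is the set of $N\times M$ matrices with nonnegative entries, row sums $\mu$ and column sums $\nu$ (transport plans); $\operatorname{EP}(\mu,\nu)$ is the finite set of extreme points of $\Pi(\mu,\nu)$. For $\pi\in\Pi(\mu,\nu)$, $\operatorname{supp}\pi=\{(i,j):\pi_{i,j}>0\}$. For $c\in\mathbb R^{N\times M}$, $\mathcal T_c(\mu,\nu)=\min_{\pi\in\Pi(\mu,\nu)}\langle c,\pi\rangle$ with the Frobenius inner product. For $f\in\mathbb R^N,g\in\mathbb R^M$, $f\oplus g$ is the $N\times M$ matrix with entries $f_i+g_j$, and $\Phi_c=\{(f,g)\in\mathbb R^N\times\mathbb R^M: f_i+g_j\le c_{i,j}\text{ for all }i,j\}$. A pair $(f,g)\in\Phi_c$ is a pair of optimal potentials for $(\mu,\nu)$ and $c$ if $\langle f,\mu\rangle+\langle g,\nu\rangle=\mathcal T_c(\mu,\nu)$. Here the observed information consists of the marginals, total costs and optimal potentials. A cost matrix $c\in\mathbb R^{N\times M}$ is called consistent if for all $k\in\{1,\dots,K\}$: $(f^{(k)},g^{(k)})\in\Phi_c$ and $\mathcal T_c(\mu^{(k)},\nu^{(k)})=\alpha^{(k)}=\langle f^{(k)},\mu^{(k)}\rangle+\langle g^{(k)},\nu^{(k)}\rangle$. When discussing identifiability it is always assumed that at least one consistent cost matrix exists (the underlying cost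 matrix); the cost matrix is identifiable in $\mathbb R^{N\times M}$ if there is exactly one consistent cost matrix. *)

(* Defs.v *)
From mathcomp Require Import all_boot all_order all_algebra.
From mathcomp Require Import all_classical all_reals all_analysis.
Set Implicit Arguments.
Unset Strict Implicit.
Unset Printing Implicit Defensive.
Import Order.TTheory GRing.Theory Num.Theory.
Import numFieldNormedType.Exports.
Local Open Scope classical_set_scope.
Local Open Scope ring_scope.

(* Frobenius inner product; at m = 1 this is the inner product of row vectors. *)
Definition mxdot (R : realType) (m n : nat) (A B : 'M[R]_(m, n)) : R :=
  \sum_i \sum_j A i j * B i j.

Definition simplex (R : realType) (n : nat) : set 'rV[R]_n :=
  [set x | (forall i, 0 <= x 0 i) /\ \sum_i x 0 i = 1].

Definition transport_plans (R : realType) (N M : nat)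
    (mu : 'rV[R]_N) (nu : 'rV[R]_M) : set 'M[R]_(N, M) :=
  [set p | [/\ forall i j, 0 <= p i j,
               forall i, \sum_j p i j = mu 0 i
             & forall j, \sum_i p i j = nu 0 j]].

Definition extreme_points (R : realType) (V : lmodType R) (A : set V) : set V :=
  [set x | A x /\
    forall (y z : V) (t : R), A y -> A z -> 0 < t < 1 ->
      x = t *: y + (1 - t) *: z -> y = x /\ z = x].

Definition EP (R : realType) (N M : nat) (mu : 'rV[R]_N) (nu : 'rV[R]_M) :
    set 'M[R]_(N, M) :=
  extreme_points (transport_plans mu nu).

Definition mxsupp (R : realType) (N M : nat) (p : 'M[R]_(N, M)) :
    set ('I_N * 'I_M) :=
  [set ij | 0 < p ij.1 ij.2].

(* The infimum is a minimum when mu and nu are probability vectors: see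
   [transport_cost_min] below. *)
Definition transport_cost (R : realType) (N M : nat) (c : 'M[R]_(N, M))
    (mu : 'rV[R]_N) (nu : 'rV[R]_M) : R :=
  inf [set mxdot c p | p in transport_plans mu nu].

Definition oplus (R : realType) (N M : nat) (f : 'rV[R]_N) (g : 'rV[R]_M) :
    'M[R]_(N, M) :=
  \matrix_(i, j) (f 0 i + g 0 j).

Definition dual_feasible (R : realType) (N M : nat) (c : 'M[R]_(N, M)) :
    set ('rV[R]_N * 'rV[R]_M) :=
  [set fg : 'rV[R]_N * 'rV[R]_M | forall i j, fg.1 0 i + fg.2 0 j <= c i j].

Definition consistent (R : realType) (K N M : nat)
    (mu : 'I_K -> 'rV[R]_N) (nu : 'I_K -> 'rV[R]_M) (alpha : 'I_K -> R)
    (f : 'I_K -> 'rV[R]_N) (g : 'I_K -> 'rV[R]_M) (c : 'M[R]_(N, M)) : Prop :=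
  forall k, [/\ dual_feasible c (f k, g k),
                transport_cost c (mu k) (nu k) = alpha k
              & alpha k = mxdot (f k) (mu k) + mxdot (g k) (nu k)].

Definition identifiable (R : realType) (K N M : nat)
    (mu : 'I_K -> 'rV[R]_N) (nu : 'I_K -> 'rV[R]_M) (alpha : 'I_K -> R)
    (f : 'I_K -> 'rV[R]_N) (g : 'I_K -> 'rV[R]_M) : Prop :=
  exists! c : 'M[R]_(N, M), consistent mu nu alpha f g c.

Definition extreme_choice (R : realType) (K N M : nat)
    (mu : 'I_K -> 'rV[R]_N) (nu : 'I_K -> 'rV[R]_M)
    (u : 'I_K -> 'M[R]_(N, M)) : Prop :=
  forall k, EP (mu k) (nu k) (u k).

Definition extreme_system (R : realType) (K N M : nat)
    (mu : 'I_K -> 'rV[R]_N) (nu : 'I_K -> 'rV[R]_M) (alpha : 'I_K -> R)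
    (f : 'I_K -> 'rV[R]_N) (g : 'I_K -> 'rV[R]_M)
    (u : 'I_K -> 'M[R]_(N, M)) (c : 'M[R]_(N, M)) : Prop :=
  forall k,
    [/\ forall v, (EP (mu k) (nu k) `\ u k) v -> alpha k <= mxdot c v,
        mxdot c (u k) = alpha k,
        forall i j, oplus (f k) (g k) i j <= c i j
      & forall i j, mxsupp (u k) (i, j) -> c i j = oplus (f k) (g k) i j].

Lemma transport_plans_neq0 (R : realType) (N M : nat)
    (mu : 'rV[R]_N) (nu : 'rV[R]_M) :
  simplex mu -> simplex nu -> transport_plans mu nu !=set0.
Proof.
case=> mu0 smu [nu0 snu].
exists (mu^T *m nu); split => [i j|i|j].
- by rewrite !mxE big_ord1 !mxE mulr_ge0.
- under eq_bigr do rewrite !mxE big_ord1 !mxE.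
  by rewrite -mulr_sumr snu mulr1.
- under eq_bigr do rewrite !mxE big_ord1 !mxE.
  by rewrite -mulr_suml smu mul1r.
Qed.

Lemma continuous_sum_rV (R : realType) (n : nat) (I : finType)
    (F : I -> 'rV[R]_n -> R) :
  (forall i, continuous (F i)) -> continuous (fun v => \sum_i F i v).
Proof.
by move=> cF; apply: continuous_big => [|i _ v]; [exact: add_continuous|exact: cF].
Qed.

Lemma continuous_vec_mx_coord (R : realType) (N M : nat) (i : 'I_N) (j : 'I_M) :
  continuous (fun v : 'rV[R]_(N * M) => (vec_mx v : 'M[R]_(N, M)) i j : R).
Proof.
have -> : (fun v : 'rV[R]_(N * M) => (vec_mx v : 'M[R]_(N, M)) i j : R) =
          (fun v => v 0 (mxvec_index i j)) by apply/funext => v; rewrite mxE.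
exact: coord_continuous.
Qed.

Lemma compact_vec_transport_plans (R : realType) (N M : nat)
    (mu : 'rV[R]_N) (nu : 'rV[R]_M) :
  compact [set v : 'rV[R]_(N * M) | transport_plans mu nu (vec_mx v)].
Proof.
set A := [set v | _].
have box : compact [set v : 'rV[R]_(N * M) | forall l,
    `[0, \sum_i `|mu 0 i|]%classic (v 0 l)].
  apply: (@rV_compact R _ (fun=> `[0, \sum_i `|mu 0 i|]%classic)) => _.
  exact: segment_compact.
apply: subclosed_compact box _.
- have -> : A =
    (\bigcap_i \bigcap_j ((fun v : 'rV[R]_(N * M) => (vec_mx v : 'M[R]_(N, M)) i j)
       @^-1` [set x | 0 <= x])) `&`
    ((\bigcap_i ((fun v : 'rV[R]_(N * M) => \sum_j (vec_mx v : 'M[R]_(N, M)) i j)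
       @^-1` [set x | x = mu 0 i])) `&`
    (\bigcap_j ((fun v : 'rV[R]_(N * M) => \sum_i (vec_mx v : 'M[R]_(N, M)) i j)
       @^-1` [set x | x = nu 0 j]))).
    apply/seteqP; split => v.
      case=> h1 h2 h3; split; first by move=> i _ j _; exact: h1.
      by split => i _; [exact: h2|exact: h3].
    case=> h1 [h2 h3]; split => [i j|i|j]; [exact: (h1 i _ j)|exact: h2|exact: h3].
  apply: closedI; last apply: closedI.
  + apply: closed_bigI => i _; apply: closed_bigI => j _.
    apply: preimage_closed (@closed_ge R 0) => v _.
    exact: continuous_vec_mx_coord.
  + apply: closed_bigI => i _; apply: preimage_closed (@closed_eq R _) => v _.
    by apply: continuous_sum_rV => j; exact: continuous_vec_mx_coord.
  + apply: closed_bigI => j _; apply: preimage_closed (@closed_eq R _) => v _.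
    by apply: continuous_sum_rV => i; exact: continuous_vec_mx_coord.
- move=> v [v0 vmu _] l.
  case/mxvec_indexP: l => i j.
  have -> : v 0 (mxvec_index i j) = (vec_mx v : 'M[R]_(N, M)) i j by rewrite mxE.
  rewrite /= in_itv /= v0 /=.
  apply: (@le_trans _ _ (\sum_j (vec_mx v : 'M[R]_(N, M)) i j)).
    by rewrite (bigD1 j) //= lerDl; apply: sumr_ge0.
  rewrite vmu (le_trans (ler_norm _)) // (bigD1 i) //= lerDl.
  by apply: sumr_ge0.
Qed.

Lemma transport_cost_min (R : realType) (N M : nat) (c : 'M[R]_(N, M))
    (mu : 'rV[R]_N) (nu : 'rV[R]_M) :
  simplex mu -> simplex nu ->
  (exists2 p, transport_plans mu nu p & mxdot c p = transport_cost c mu nu) /\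
  (forall p, transport_plans mu nu p -> transport_cost c mu nu <= mxdot c p).
Proof.
move=> mu1 nu1.
have [p0 Pp0] := transport_plans_neq0 mu1 nu1.
have [||v vP vmin] := @EVT_min_rV R _ (fun v => mxdot c (vec_mx v)) _ _
  (@compact_vec_transport_plans R N M mu nu).
- by exists (mxvec p0); rewrite /= mxvecK.
- apply: continuous_subspaceT.
  apply: continuous_sum_rV => i; apply: continuous_sum_rV => j v.
  by apply: (@cvgM R _ (nbhs v)); [exact: cvg_cst|exact: continuous_vec_mx_coord].
rewrite inE /= in vP.
have min p : transport_plans mu nu p -> mxdot c (vec_mx v) <= mxdot c p.
  by move=> Pp; have := vmin (mxvec p); rewrite inE /= mxvecK => /(_ Pp).
have lb : lbound [set mxdot c p | p in transport_plans mu nu]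
    (mxdot c (vec_mx v)) by move=> _ [p Pp <-]; exact: min.
have -> : transport_cost c mu nu = mxdot c (vec_mx v).
  apply/eqP; rewrite eq_le; apply/andP; split.
    apply: ge_inf; first by exists (mxdot c (vec_mx v)).
    by exists (vec_mx v).
  by apply: lb_le_inf => //; exists (mxdot c p0), p0.
by split => //; exists (vec_mx v).
Qed.

(* Main.v *)
Require Import Defs.
From mathcomp Require Import all_boot all_order all_algebra.
From mathcomp Require Import all_classical all_reals all_analysis.
From mathcomp Require Import ring lra.
Set Implicit Arguments.
Unset Strict Implicit.
Unset Printing Implicit Defensive.
Import Order.TTheory GRing.Theory Num.Theory.
Import numFieldNormedType.Exports.
Local Open Scope classical_set_scope.
Local Open Scope ring_scope.

(** The theorem rests on one equivalence: a cost matrix is consistent if and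
    only if it solves the system for some choice of extreme points
    ([consistentP]).  Granted this, the set of consistent matrices is the union
    over all choices [u] of the solution sets of the systems, and both parts
    compare this union with its members: when nonempty, it is a single point
    exactly when each member is empty or that same point, and it is nonempty as
    soon as one member is.

    A solution is consistent by weak duality ([mxdot_oplus],
    [ler_mxdot]): since [c] dominates [f (+) g], every plan costs at least
    [alpha], and [u] attains this bound.

    Conversely, let [c] be consistent.  A linear functional on the transport
    polytope attains its minimum at an extreme point
    ([extreme_optimal_plan]); taking such points for [u] gives the conditions on
    costs, and equality on the support of [u] is complementary slackness
    ([complementary_slackness]).  The extreme minimizer is found without any
    polyhedral theory: among the minimizers, which form a compact set, take one
    of largest Euclidean norm.  If it were a proper convex combination of two
    plans, these would be minimizers as well, hence of no larger norm, and
    strict convexity of the squared norm forces them to coincide. *)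

(** * The Frobenius inner product *)

Section Mxdot.
Context (R : realType) (m n : nat).
Implicit Types (A B C : 'M[R]_(m, n)) (t : R).

Lemma mxdotC A B : mxdot A B = mxdot B A.
Proof.
by apply: eq_bigr => i _; apply: eq_bigr => j _; rewrite mulrC.
Qed.

Lemma mxdotDr A B C : mxdot A (B + C) = mxdot A B + mxdot A C.
Proof.
rewrite /mxdot -big_split; apply: eq_bigr => i _.
by rewrite -big_split; apply: eq_bigr => j _; rewrite mxE mulrDr.
Qed.

Lemma mxdotZr t A B : mxdot A (t *: B) = t * mxdot A B.
Proof.
rewrite /mxdot mulr_sumr; apply: eq_bigr => i _.
by rewrite mulr_sumr; apply: eq_bigr => j _; rewrite mxE mulrCA.
Qed.

Lemma mxdotDl A B C : mxdot (A + B) C = mxdot A C + mxdot B C.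
Proof. by rewrite mxdotC mxdotDr !(mxdotC C). Qed.

Lemma mxdotZl t A B : mxdot (t *: A) B = t * mxdot A B.
Proof. by rewrite mxdotC mxdotZr mxdotC. Qed.

Lemma mxdotBl A B C : mxdot (A - B) C = mxdot A C - mxdot B C.
Proof. by rewrite mxdotDl -scaleN1r mxdotZl mulN1r. Qed.

Lemma mxdot_ge0_eq0 A B :
  (forall i j, 0 <= A i j) -> (forall i j, 0 <= B i j) -> mxdot A B = 0 ->
  forall i j, A i j * B i j = 0.
Proof.
move=> A0 B0 AB0 i j.
have AB_ge0 i' j' : 0 <= A i' j' * B i' j' by rewrite mulr_ge0.
move: AB0 => /eqP; rewrite psumr_eq0 => [/allP/(_ i)|i' _]; last first.
  exact: sumr_ge0.
rewrite mem_index_enum => /(_ isT); rewrite /= psumr_eq0 // => /allP/(_ j).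
by rewrite mem_index_enum => /(_ isT)/eqP.
Qed.

Lemma ler_mxdot A B C :
  (forall i j, 0 <= C i j) -> (forall i j, A i j <= B i j) ->
  mxdot A C <= mxdot B C.
Proof.
move=> C0 AB; apply: ler_sum => i _; apply: ler_sum => j _.
exact: ler_wpM2r.
Qed.

Lemma mxdot_self_le0 A : mxdot A A <= 0 -> A = 0.
Proof.
move=> A0; apply/matrixP => i j; rewrite mxE.
have sq_ge0 i' j' : 0 <= A i' j' * A i' j' by rewrite -expr2 sqr_ge0.
have row_le : A i j * A i j <= \sum_j' A i j' * A i j'.
  by rewrite (bigD1 j) //= lerDl sumr_ge0.
have all_le : \sum_j' A i j' * A i j' <= mxdot A A.
  rewrite /mxdot (bigD1 i) //= lerDl; apply: sumr_ge0 => i' _.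
  exact: sumr_ge0.
have /eqP : A i j * A i j = 0.
  by apply/eqP; rewrite eq_le sq_ge0 (le_trans row_le) ?(le_trans all_le).
by rewrite mulf_eq0 orbb => /eqP.
Qed.

(** The defect in Jensen's inequality for the squared norm is
    [t (1 - t) |A - B|^2], so a strict convex combination whose norm is at least
    that of both its terms must be degenerate. *)
Lemma sqnorm_strictly_convex A B t : 0 < t < 1 ->
  let C := t *: A + (1 - t) *: B in
  mxdot A A <= mxdot C C -> mxdot B B <= mxdot C C -> A = B.
Proof.
case/andP=> t0 t1 C AC BC; apply: subr0_eq; apply: mxdot_self_le0.
rewrite -(pmulr_rle0 _ t0) -(pmulr_rle0 (_ * _) (_ : 0 < 1 - t)) ?subr_gt0 //.
have -> : (1 - t) * (t * mxdot (A - B) (A - B)) =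
    t * mxdot A A + (1 - t) * mxdot B B - mxdot C C.
  rewrite /C -[- B]scaleN1r !(mxdotDl, mxdotDr, mxdotZl, mxdotZr) (mxdotC B A).
  by ring.
have : t * mxdot A A <= t * mxdot C C by rewrite ler_pM2l.
have : (1 - t) * mxdot B B <= (1 - t) * mxdot C C by rewrite ler_pM2l ?subr_gt0.
lra.
Qed.

End Mxdot.

(** * Extreme optimal plans *)

Lemma continuous_mxdot (R : realType) (m n : nat)
    (F G : 'rV[R]_(m * n) -> 'M[R]_(m, n)) :
  (forall i j, continuous (fun v => F v i j : R)) ->
  (forall i j, continuous (fun v => G v i j : R)) ->
  continuous (fun v => mxdot (F v) (G v)).
Proof.
move=> cF cG; apply: continuous_sum_rV => i; apply: continuous_sum_rV => j v.
by apply: (@cvgM R _ (nbhs v)); [exact: cF|exact: cG].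
Qed.

Section ExtremeOptimalPlan.
Context (R : realType) (N M : nat).
Variables (c : 'M[R]_(N, M)) (mu : 'rV[R]_N) (nu : 'rV[R]_M).
Hypotheses (mu1 : simplex mu) (nu1 : simplex nu).

Definition optimal_plans : set 'M[R]_(N, M) :=
  [set p | transport_plans mu nu p /\ mxdot c p = transport_cost c mu nu].

Lemma compact_vec_optimal_plans :
  compact [set v : 'rV[R]_(N * M) | optimal_plans (vec_mx v)].
Proof.
have -> : [set v : 'rV[R]_(N * M) | optimal_plans (vec_mx v)] =
    [set v | transport_plans mu nu (vec_mx v)] `&`
    ((fun v => mxdot c (vec_mx v)) @^-1` [set x | x = transport_cost c mu nu]).
  by [].
apply: compact_closedI; first exact: compact_vec_transport_plans.
apply: preimage_closed (@closed_eq R _) => v _.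
apply: continuous_mxdot => i j; first exact: cst_continuous.
exact: continuous_vec_mx_coord.
Qed.

Lemma optimal_plan_largest_norm :
  exists2 p, optimal_plans p &
    forall q, optimal_plans q -> mxdot q q <= mxdot p p.
Proof.
have [[p0 Pp0 cp0] _] := transport_cost_min c mu1 nu1.
have [||v + vmax] := @EVT_max_rV R _ (fun v => mxdot (vec_mx v) (vec_mx v))
  _ _ compact_vec_optimal_plans.
- by exists (mxvec p0); rewrite /= mxvecK.
- apply: continuous_subspaceT.
  by apply: continuous_mxdot => i j; exact: continuous_vec_mx_coord.
rewrite inE /= => vopt; exists (vec_mx v) => // q qopt.
by have := vmax (mxvec q); rewrite inE /= mxvecK => /(_ qopt).
Qed.

Lemma optimal_plans_face y z t : 0 < t < 1 ->
  transport_plans mu nu y -> transport_plans mu nu z ->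
  optimal_plans (t *: y + (1 - t) *: z) -> optimal_plans y /\ optimal_plans z.
Proof.
case/andP=> t0 t1 Py Pz [_]; rewrite mxdotDr !mxdotZr => cyz.
have [_ cmin] := transport_cost_min c mu1 nu1.
have t10 : 0 < 1 - t by rewrite subr_gt0.
have ty : t * transport_cost c mu nu <= t * mxdot c y by rewrite ler_pM2l ?cmin.
have tz : (1 - t) * transport_cost c mu nu <= (1 - t) * mxdot c z.
  by rewrite ler_pM2l ?cmin.
split; split=> //.
  by apply: (mulfI (lt0r_neq0 t0)); lra.
by apply: (mulfI (lt0r_neq0 t10)); lra.
Qed.

(** Maximizing the norm over the optimal plans selects an extreme point of that
    face, hence of the whole polytope. *)
Lemma extreme_optimal_plan :
  exists2 u, EP mu nu u & mxdot c u = transport_cost c mu nu.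
Proof.
have [u [Pu cu] umax] := optimal_plan_largest_norm.
exists u => //; split=> // y z t Py Pz t01 uE.
have [yopt zopt] : optimal_plans y /\ optimal_plans z.
  by apply: (optimal_plans_face t01) => //; rewrite -uE.
have yz : y = z.
  by apply: (sqnorm_strictly_convex t01); rewrite -uE; exact: umax.
by rewrite uE yz -scalerDl addrC subrK scale1r.
Qed.

End ExtremeOptimalPlan.

(** * Duality *)

(** A plan sees the separable matrix [f (+) g] only through its marginals. *)
Lemma mxdot_oplus (R : realType) (N M : nat) (f mu : 'rV[R]_N)
    (g nu : 'rV[R]_M) p :
  transport_plans mu nu p -> mxdot (oplus f g) p = mxdot f mu + mxdot g nu.
Proof.
case=> _ pmu pnu; rewrite /mxdot !big_ord1.
transitivity (\sum_i \sum_j f 0 i * p i j + \sum_i \sum_j g 0 j * p i j).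
  rewrite -big_split; apply: eq_bigr => i _; rewrite -big_split.
  by apply: eq_bigr => j _; rewrite mxE mulrDl.
congr (_ + _); first by apply: eq_bigr => i _; rewrite -mulr_sumr pmu.
by rewrite exchange_big; apply: eq_bigr => j _; rewrite -mulr_sumr pnu.
Qed.

(** With no duality gap, the nonnegative slack [c - f (+) g] is orthogonal to
    the nonnegative plan, so each of their entrywise products vanishes. *)
Lemma complementary_slackness (R : realType) (N M : nat) (c : 'M[R]_(N, M))
    (f mu : 'rV[R]_N) (g nu : 'rV[R]_M) p :
  dual_feasible c (f, g) -> transport_plans mu nu p ->
  mxdot c p = mxdot f mu + mxdot g nu ->
  forall i j, mxsupp p (i, j) -> c i j = oplus f g i j.
Proof.
move=> fgc Pp gap i j pij.
have /(_ i j)/eqP : forall i j, (c - oplus f g) i j * p i j = 0.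
  apply: mxdot_ge0_eq0 => [i' j'|i' j'|]; last 1 first.
  - by rewrite mxdotBl (mxdot_oplus f g Pp) gap subrr.
  - by rewrite !mxE subr_ge0; exact: fgc.
  - by case: Pp.
rewrite mulf_eq0 (gt_eqF pij) orbF.
by rewrite [X in X == _]mxE [X in _ + X]mxE subr_eq0 => /eqP.
Qed.

(** * Consistency and the extreme point systems *)

Section ConsistentP.
Context (R : realType) (K N M : nat).
Variables (mu : 'I_K -> 'rV[R]_N) (nu : 'I_K -> 'rV[R]_M) (alpha : 'I_K -> R).
Variables (f : 'I_K -> 'rV[R]_N) (g : 'I_K -> 'rV[R]_M).
Hypothesis mu_simplex : forall k, simplex (mu k).
Hypothesis nu_simplex : forall k, simplex (nu k).
Hypothesis alphaE : forall k, alpha k = mxdot (f k) (mu k) + mxdot (g k) (nu k).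

Lemma extreme_system_consistent u c : extreme_choice mu nu u ->
  extreme_system mu nu alpha f g u c -> consistent mu nu alpha f g c.
Proof.
move=> uEP uc k; have [_ cu fgc _] := uc k; split; last exact: alphaE.
  by move=> i j; have := fgc i j; rewrite mxE.
have [[p Pp cp] cmin] := transport_cost_min c (mu_simplex k) (nu_simplex k).
apply/eqP; rewrite eq_le; apply/andP; split.
  by rewrite -cu; apply: cmin; case: (uEP k).
rewrite -cp alphaE -(mxdot_oplus (f k) (g k) Pp).
by apply: ler_mxdot => //; case: Pp.
Qed.

Lemma consistent_extreme_system c : consistent mu nu alpha f g c ->
  exists2 u, extreme_choice mu nu u & extreme_system mu nu alpha f g u c.
Proof.
move=> cons.
have /choice[u uopt] k : exists u,
    EP (mu k) (nu k) u /\ mxdot c u = transport_cost c (mu k) (nu k).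
  have [u uEP cu] := extreme_optimal_plan c (mu_simplex k) (nu_simplex k).
  by exists u.
exists u => k; first by have [] := uopt k.
have [[Pu _] cu] := uopt k.
have [fgc ca _] := cons k.
have [_ cmin] := transport_cost_min c (mu_simplex k) (nu_simplex k).
split.
- by move=> v [[Pv _] _]; rewrite -ca; exact: cmin.
- by rewrite cu.
- by move=> i j; rewrite mxE; exact: fgc.
- by apply: (complementary_slackness fgc Pu); rewrite cu ca alphaE.
Qed.

Lemma consistentP c : consistent mu nu alpha f g c <->
  exists2 u, extreme_choice mu nu u & extreme_system mu nu alpha f g u c.
Proof.
split; first exact: consistent_extreme_system.
by case=> u; exact: extreme_system_consistent.
Qed.

End ConsistentP.

Theorem theorem2p14 (R : realType) (K N M : nat)
    (mu : 'I_K -> 'rV[R]_N) (nu : 'I_K -> 'rV[R]_M) (alpha : 'I_K -> R)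
    (f : 'I_K -> 'rV[R]_N) (g : 'I_K -> 'rV[R]_M)
    (mu_simplex : forall k, simplex (mu k))
    (nu_simplex : forall k, simplex (nu k))
    (marginals_distinct : injective (fun k => (mu k, nu k)))
    (alphaE : forall k, alpha k = mxdot (f k) (mu k) + mxdot (g k) (nu k)) :
  ((exists c : 'M[R]_(N, M), consistent mu nu alpha f g c) ->
    (identifiable mu nu alpha f g <->
      (forall u : 'I_K -> 'M[R]_(N, M), extreme_choice mu nu u ->
        (~ exists c : 'M[R]_(N, M), extreme_system mu nu alpha f g u c) \/
        (exists! c : 'M[R]_(N, M), extreme_system mu nu alpha f g u c)) /\
      (forall (u u' : 'I_K -> 'M[R]_(N, M)) (c c' : 'M[R]_(N, M)),
        extreme_choice mu nu u -> extreme_choice mu nu u' ->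
        extreme_system mu nu alpha f g u c ->
        extreme_system mu nu alpha f g u' c' -> c = c'))) /\
  ((exists u : 'I_K -> 'M[R]_(N, M), extreme_choice mu nu u /\
      exists c : 'M[R]_(N, M), extreme_system mu nu alpha f g u c) ->
    exists c : 'M[R]_(N, M), consistent mu nu alpha f g c).
Proof.
have consE := consistentP mu_simplex nu_simplex alphaE.
split; last first.
  by case=> u [uEP [c uc]]; exists c; apply/consE; exists u.
case=> c0 c0cons; split.
- case=> c [_ cuniq].
  have system_sol u c' : extreme_choice mu nu u ->
      extreme_system mu nu alpha f g u c' -> c = c'.
    by move=> uEP uc'; apply: cuniq; apply/consE; exists u.
  split=> [u uEP|u u' c1 c2 uEP u'EP uc1 u'c2]; last first.
    by rewrite -(system_sol u c1) // (system_sol u' c2).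
  have [[c' uc']|nosol] := pselect (exists c', extreme_system mu nu alpha f g u c').
    right; exists c'; split=> // c'' uc''.
    by rewrite -(system_sol u c') // (system_sol u c'').
  by left.
- case=> _ indep; exists c0; split=> // c ccons.
  move/consE: c0cons => [u uEP uc0]; move/consE: ccons => [u' u'EP u'c].
  exact: (indep u u').
Qed.
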